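(* Let $(S_n)_{n\in\mathbb N}$ be a sequence of centered real random variables that admits uniform bounds on cumulants with parameters $(D_n,N_n,A)$. Set $$(\widetilde\sigma_n)^2=\frac{\mathrm{Var}(S_n)}{N_nD_n},\qquad X_n=\frac{S_n}{(N_n)^{1/3}(D_n)^{2/3}},\qquad t_n=(\widetilde\sigma_n)^2\left(\frac{N_n}{D_n}\right)^{1/3}=\mathrm{Var}(X_n).$$ Then $(X_n)$ has, with respect to the standard Gaussian law, a zone of control $[-K\,t_n,K\,t_n]$ of index $(3,3)$ with constants $$K=\frac{1}{(8+4e)A^3},\qquad K_1=K_2=(2+e)A^3.$$ That is, for all $n$ and all $\xi\in[-K\,t_n,K\,t_n]$, the function $\theta_n(\xi)=\mathbb E[e^{i\xi X_n}]\,e^{t_n\xi^2/2}$ satisfies $|\theta_n(\xi)-1|\le K_1|\xi|^3\exp(K_2|\xi|^3)$, and moreover $0<K\le\frac{1}{4K_2}$.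
   Context: The cumulants $\kappa^{(r)}(X)$ of a real random variable $X$ whose exponential generating function converges near $0$ are defined by $\log\mathbb E[e^{zX}]=\sum_{r\ge1}\frac{\kappa^{(r)}(X)}{r!}z^r$. A sequence $(S_n)$ of centered real random variables (with exponential generating functions convergent near $0$) admits uniform bounds on cumulants with parameters $(D_n,N_n,A)$ (where $D_n,N_n,A>0$) if for all $n$ and all $r\ge2$, $|\kappa^{(r)}(S_n)|\le N_n\,r^{r-2}(2D_n)^{r-1}A^r$. Here $e=\exp(1)$ in the constants. For the standard Gaussian reference law, a zone of control $[-K(t_n)^\gamma,K(t_n)^\gamma]$ of index $(v,w)=(3,3)$ with $\gamma=1$ means exactly the two properties spelled out in the last sentence of the claim. *)

(* Defs.v *)
From HB Require Import structures.
From mathcomp Require Import all_boot all_order all_algebra.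
From mathcomp Require Import all_classical all_reals all_analysis.
From mathcomp Require Import complex.
Set Implicit Arguments.
Unset Strict Implicit.
Unset Printing Implicit Defensive.
Import Order.TTheory GRing.Theory Num.Theory.
Import numFieldNormedType.Exports.
Local Open Scope classical_set_scope.
Local Open Scope ring_scope.
Local Open Scope complex_scope.

(* The exponential generating function E[e^{zX}] converges near 0. Real z
   suffice: for complex z, |e^{zX}| = e^{Re(z) X}. *)
Definition egf_converges (d : measure_display) (T : measurableType d)
    (R : realType) (P : probability T R) (X : T -> R) : Prop :=
  \forall z \near (0 : R), ('M_P X z < +oo)%E.

(* log E[e^{zX}] = \sum_(r >= 1) k r / r! * z ^ r near 0. An identity of power
   series is determined by real z, where ln is the logarithm of a positive real.
   The normalisation k 0 = 0 makes the series start at r = 1. *)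
Definition is_cumulants (d : measure_display) (T : measurableType d)
    (R : realType) (P : probability T R) (X : T -> R) (k : nat -> R) : Prop :=
  k 0%N = 0 /\
  \forall z \near (0 : R),
    pseries (fun r => k r / r`!%:R) z @ \oo --> ln (fine ('M_P X z)).

(* The sequence of coefficients is unique when it exists, which is the case as
   soon as [egf_converges P X]; the value is meaningless otherwise. *)
Definition cumulant (d : measure_display) (T : measurableType d)
    (R : realType) (P : probability T R) (X : T -> R) : nat -> R :=
  xget (fun=> 0) [set k : nat -> R | is_cumulants P X k].

(* The n-th variable may live on its own probability space. *)
Definition uniform_cumulant_bounds (R : realType) (d : nat -> measure_display)
    (T : forall n, measurableType (d n)) (P : forall n, probability (T n) R)
    (S : forall n, T n -> R) (D N : nat -> R) (A : R) : Prop :=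
  forall n r : nat, (2 <= r)%N ->
    `|cumulant (P n) (S n) r|
      <= N n * r%:R ^+ (r - 2) * (2 * D n) ^+ (r - 1) * A ^+ r.

(* E[e^{i xi X}], the expectation being taken on real and imaginary parts. *)
Definition char_fun (d : measure_display) (T : measurableType d)
    (R : realType) (P : probability T R) (X : T -> R) (xi : R) : R[i] :=
  fine ('E_P[(fun x => cos (xi * X x))])
    +i* fine ('E_P[(fun x => sin (xi * X x))]).

(* E[e^{i xi X}] e^{t xi^2 / 2} *)
Definition gaussian_residue (d : measure_display) (T : measurableType d)
    (R : realType) (P : probability T R) (X : T -> R) (t xi : R) : R[i] :=
  char_fun P X xi * (expR (t * xi ^+ 2 / 2))%:C.

(* Main.v *)
Require Import Defs.
From HB Require Import structures.
From mathcomp Require Import all_boot all_order all_algebra.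
From mathcomp Require Import all_classical all_reals all_analysis.
From mathcomp Require Import complex measurable_realfun.
From mathcomp Require Import ring lra.
Set Implicit Arguments.
Unset Strict Implicit.
Unset Printing Implicit Defensive.
Import Order.TTheory GRing.Theory Num.Theory.
Import numFieldNormedType.Exports.
Local Open Scope classical_set_scope.
Local Open Scope ring_scope.

(* Write m_n = E[S^n] / n! and c_r = k_r / r! for the cumulants k_r. The identity
   M = exp K of generating functions amounts to M' = K' M, a recursion between
   the m_n and the c_r. The bounds on cumulants give K a radius of convergence of
   at least 1 / (2 e D A), and by the recursion the m_n inherit it; hence exp (s |S|) is
   integrable, and E[exp (i s S)] is the sum of its power series, for every s
   within that radius, although M is only assumed to be finite near 0. There the
   recursion is the differential equation satisfied by exp (K (i s)), so that
   E[exp (i s S)] = exp (K (i s)) without any analytic continuation. Finally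
   c_1 = 0, the term c_2 cancels the Gaussian factor, the terms with r >= 3 are
   dominated by a geometric series, and |exp w - 1| <= |w| exp |w|. *)

(** * Real power series with geometrically bounded coefficients *)

Section PowerSeries.
Variable R : realType.
Implicit Types (a b c : nat -> R) (B C s : R).

(** A quantitative form of a radius of convergence at least [1 / B]. The constant is left
    existential because only the rate [B] has to be tracked. *)
Definition geometric_bound c B := exists C, forall n, `|c n| <= C * B ^+ n.

Lemma geometric_bound_cst_ge0 c B C : (forall n, `|c n| <= C * B ^+ n) -> 0 <= C.
Proof. by move=> /(_ 0%N); rewrite expr0 mulr1; apply: le_trans. Qed.

Lemma geometric_bound_le c B B' : 0 <= B -> B <= B' ->
  geometric_bound c B -> geometric_bound c B'.
Proof.
move=> B0 BB' [C cC]; exists C => n; apply: le_trans (cC n) _.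
rewrite ler_wpM2l ?(geometric_bound_cst_ge0 cC)//.
by rewrite lerXn2r ?nnegrE// (le_trans B0).
Qed.

Lemma geometric_bound_dominated a c B :
  (forall n, `|a n| <= `|c n|) -> geometric_bound c B -> geometric_bound a B.
Proof. by move=> ac [C cC]; exists C => n; apply: le_trans (ac n) (cC n). Qed.

Lemma geometric_boundB a c B :
  geometric_bound a B -> geometric_bound c B -> geometric_bound (a - c) B.
Proof.
move=> [C aC] [C' cC']; exists (C + C') => n.
by rewrite mulrDl (le_trans (ler_normB _ _))// lerD.
Qed.

Lemma is_cvg_pseries_geometric_bound c B s : 0 <= B -> B * `|s| < 1 ->
  geometric_bound c B -> cvgn (pseries c s).
Proof.
move=> B0 Bs [C cC]; apply: normed_cvg.
apply: (@series_le_cvg _ _ (geometric C (B * `|s|))).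
- by move=> n; exact: normr_ge0.
- move=> n /=; rewrite mulr_ge0 ?(geometric_bound_cst_ge0 cC)// exprn_ge0//.
  by rewrite mulr_ge0.
- by move=> n /=; rewrite normrM normrX exprMn mulrA ler_wpM2r ?exprn_ge0.
- by apply: is_cvg_geometric_series; rewrite normrM normr_id ger0_norm.
Qed.

Lemma geometric_bound_cvg_pseries c s : s != 0 ->
  cvgn (pseries c s) -> geometric_bound c `|s|^-1.
Proof.
move=> s0 /cvg_series_bounded[M [_ Mc]]; exists (M + 1) => n.
have := Mc (M + 1) _ n I; rewrite /= ltrDl ltr01 => /(_ isT).
by rewrite exprVn normrM normrX -ler_pdivlMr ?exprn_gt0 ?normr_gt0.
Qed.

Lemma bernoulli_inequality (h : R) n : 0 <= h -> 1 + n%:R * h <= (1 + h) ^+ n.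
Proof.
move=> h0; elim: n => [|n IH]; first by rewrite mul0r addr0 expr0.
rewrite exprS -natr1; apply: le_trans (_ : (1 + h) * (1 + n%:R * h) <= _).
  have : 0 <= h * (n%:R * h) by rewrite !mulr_ge0.
  nra.
by rewrite ler_wpM2l// addr_ge0.
Qed.

(** With [1 + h = B' / B], Bernoulli's inequality gives [n * h <= (B' / B) ^ n], so [M = 1 / h]
    works. *)
Lemma natmul_geometric_le B B' : 0 <= B -> B < B' ->
  exists M, forall n, n%:R * B ^+ n <= M * B' ^+ n.
Proof.
move=> B0 BB'; have B'0 : 0 < B' by apply: le_lt_trans BB'.
have [->|Bneq0] := eqVneq B 0.
  by exists 0 => -[|n]; rewrite ?mul0r// exprS mul0r mulr0.
have Bgt0 : 0 < B by rewrite lt_def Bneq0.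
pose h := B' / B - 1.
have h0 : 0 < h by rewrite subr_gt0 ltr_pdivlMr ?mul1r.
exists h^-1 => n.
have -> : B' = B * (1 + h) by rewrite /h; field.
rewrite exprMn mulrCA [leLHS]mulrC ler_pM2l ?exprn_gt0//.
rewrite ler_pdivlMl//; have := bernoulli_inequality n (ltW h0); lra.
Qed.

(** Differentiation multiplies coefficients by a factor linear in [n], which any strict increase of
    the rate absorbs. *)
Lemma geometric_bound_diffs c B B' : 0 <= B -> B < B' ->
  geometric_bound c B -> geometric_bound (pseries_diffs c) B'.
Proof.
move=> B0 BB' [C cC]; have C0 := geometric_bound_cst_ge0 cC.
have [M Mn] := natmul_geometric_le B0 BB'.
exists (C * (M * B')) => n; rewrite /pseries_diffs normrM ger0_norm//.
apply: le_trans (ler_wpM2l _ (cC n.+1)) _ => //.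
rewrite mulrCA -mulrA ler_wpM2l//.
by apply: le_trans (Mn n.+1) _; rewrite exprS mulrA.
Qed.

(** Provides the room needed to increase the rate while keeping a given point inside the disc of
    convergence. *)
Lemma exists_gt_mulr_lt1 (r B : R) : 0 <= B -> 0 <= r -> B * r < 1 ->
  exists2 B', B < B' & B' * r < 1.
Proof.
move=> B0 r0 Br.
exists (B + (1 - B * r) / (2 * (1 + r))).
  by rewrite ltrDl divr_gt0 ?subr_gt0// mulr_gt0// ltr_pwDl.
rewrite mulrDl -ltrBrDl mulrAC -mulrA.
rewrite -[ltRHS]mulr1 ltr_pM2l ?subr_gt0//.
rewrite ltr_pdivrMr ?mul1r; last by rewrite mulr_gt0// ltr_pwDl.
lra.
Qed.

(** Termwise differentiation through [pseries_snd_diffs] asks for a point beyond [s] where the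
    series and its first two derived series converge. Two derivations use up [B1] and [B2], and
    [1 / B3] is that point. *)
Lemma is_derive_pseries c B s : 0 <= B -> B * `|s| < 1 ->
  geometric_bound c B ->
  is_derive s (1 : R) (fun x => limn (pseries c x))
    (limn (pseries (pseries_diffs c) s)).
Proof.
move=> B0 Bs gc.
have [B1 BB1 B1s] := exists_gt_mulr_lt1 B0 (normr_ge0 s) Bs.
have B10 : 0 < B1 by apply: le_lt_trans BB1.
have [B2 BB2 B2s] := exists_gt_mulr_lt1 (ltW B10) (normr_ge0 s) B1s.
have B20 : 0 < B2 by apply: lt_trans BB2.
have [B3 BB3 B3s] := exists_gt_mulr_lt1 (ltW B20) (normr_ge0 s) B2s.
have B30 : 0 < B3 by apply: lt_trans BB3.
have g1 := geometric_bound_diffs B0 BB1 gc.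
have g2 := geometric_bound_diffs (ltW B10) BB2 g1.
have nB3 : `|B3^-1| = B3^-1 by rewrite ger0_norm// invr_ge0 ltW.
have cv B' a : 0 <= B' -> B' < B3 -> geometric_bound a B' ->
    cvgn (pseries a B3^-1).
  move=> B'0 B'B3; apply: is_cvg_pseries_geometric_bound => //.
  by rewrite nB3 ltr_pdivrMr ?mul1r.
apply: (@pseries_snd_diffs _ _ B3^-1).
- by apply: cv gc => //; exact: lt_trans BB1 (lt_trans BB2 BB3).
- by apply: cv g1 => //; [exact: ltW|exact: lt_trans BB2 BB3].
- by apply: cv g2 => //; exact: ltW.
- by rewrite nB3 -[ltRHS]mul1r ltr_pdivlMr 1?mulrC.
Qed.

Lemma limn_pseries0 c : limn (pseries c 0) = c 0%N.
Proof.
apply/cvg_lim => //; apply: cvg_near_cst; near=> n.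
rewrite -[n]prednK; last by near: n; exact: nbhs_infty_gt.
rewrite /pseries /series /= big_nat_recl// expr0 mulr1 big1 ?addr0//.
by move=> i _; rewrite expr0n mulr0.
Unshelve. all: by end_near. Qed.

(* The derivative of a locally null power series is again locally null. *)
Lemma pseries_eq0 c B : 0 < B -> geometric_bound c B ->
  (\forall s \near (0 : R), limn (pseries c s) = 0) -> forall n, c n = 0.
Proof.
move=> B0 gc c0 n; elim: n c B B0 gc c0 => [|n IH] c B B0 gc c0.
  by rewrite -limn_pseries0; exact: nbhs_singleton c0.
suff : pseries_diffs c n = 0.
  by move/eqP; rewrite /pseries_diffs mulf_eq0 pnatr_eq0/= => /eqP.
have BB : B < B + B by rewrite ltrDl.
apply: (IH _ (B + B)); first exact: lt_trans BB.
  exact: geometric_bound_diffs (ltW B0) BB gc.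
have Bs : \forall s \near (0 : R), B * `|s| < 1.
  near=> s; rewrite mulrC -ltr_pdivlMr// mul1r.
  rewrite -[s]subr0 distrC; near: s.
  by apply: (@nbhsx_ballx R R); rewrite invr_gt0.
near=> s.
have Bss : B * `|s| < 1 by near: s.
have dcs := is_derive_pseries (ltW B0) Bss gc.
rewrite -(@derive_val _ _ _ _ _ _ _ dcs).
rewrite (@near_eq_derive _ _ _ _ (fun=> 0)) ?derive_cst//.
by near: s; have := near_join c0; apply.
Unshelve. all: by end_near. Qed.

End PowerSeries.

(** * Cauchy products of absolutely convergent series *)

Section CauchyProduct.
Variable R : realType.
Implicit Types (a b x y : nat -> R) (B C q s : R).

Definition cauchy_product a b n := \sum_(j < n.+1) a j * b (n - j)%N.

(** The index pairs with [j + l < n] form a triangle, summed by antidiagonals on the left and by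
    rows on the right. *)
Lemma sum_cauchy_product x y n :
  \sum_(0 <= i < n) cauchy_product x y i =
  \sum_(0 <= j < n) x j * \sum_(0 <= l < n - j) y l.
Proof.
elim: n => [|n IH]; first by rewrite !big_nil.
rewrite !big_nat_recr//= IH subSnn big_nat1 /cauchy_product big_ord_recr/=.
rewrite subnn addrA; congr (_ + _).
rewrite big_mkord -big_split/= big_mkord; apply: eq_bigr => j _.
by rewrite subSn ?(ltnW (ltn_ord j))// big_nat_recr//= mulrDr.
Qed.

Lemma sum_geometric_le q m n : 0 <= q -> q < 1 ->
  \sum_(m <= l < n) q ^+ l <= q ^+ m / (1 - q).
Proof.
move=> q0 q1; rewrite ler_pdivlMr ?subr_gt0//.
have [mn|nm] := leqP m n; last first.
  by rewrite big_geq ?(ltnW nm)// mul0r exprn_ge0.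
suff -> : (\sum_(m <= l < n) q ^+ l) * (1 - q) = q ^+ m - q ^+ n.
  by rewrite gerBl exprn_ge0.
elim: n mn => [|n IH]; first by rewrite leqn0 => /eqP->; rewrite big_nil; ring.
rewrite leq_eqVlt => /orP[/eqP->|mn]; first by rewrite big_geq//; ring.
by rewrite big_nat_recr//= mulrDl IH//= exprS; ring.
Qed.

(** The product of the partial sums runs over a square of index pairs, the partial sum of the Cauchy
    product over a triangle inside it. The gap is at most [C ^ 2 / (1 - q) * n * q ^ n], hence at
    most [L * q' ^ n] for some [q'] between [q] and 1. *)
Lemma cvg_series_cauchy_product x y C q : 0 <= q -> q < 1 ->
  (forall n, `|x n| <= C * q ^+ n) -> (forall n, `|y n| <= C * q ^+ n) ->
  series (cauchy_product x y) @ \oo --> limn (series x) * limn (series y).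
Proof.
move=> q0 q1 xC yC; have C0 := geometric_bound_cst_ge0 xC.
have cv (z : nat -> R) : (forall n, `|z n| <= C * q ^+ n) -> cvgn (series z).
  move=> zC; apply: normed_cvg; apply: (@series_le_cvg _ _ (geometric C q)) => //=.
  - by move=> n /=; rewrite mulr_ge0// exprn_ge0.
  - by apply: is_cvg_geometric_series; rewrite ger0_norm.
have := @exists_gt_mulr_lt1 _ 1 q q0 ler01 _; rewrite mulr1 => /(_ q1)[q' qq'].
rewrite mulr1 => q'1.
have [M Mn] := natmul_geometric_le q0 qq'.
suff D0 : (fun n => series x n * series y n - series (cauchy_product x y) n)
    @ \oo --> 0.
  have -> : series (cauchy_product x y) = (fun n => series x n * series y n -
      (series x n * series y n - series (cauchy_product x y) n)).
    by apply/funext => n; rewrite subKr.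
  rewrite -[X in _ --> X]subr0; apply: cvgB D0; apply: cvgM; exact: cv.
pose L := C ^+ 2 / (1 - q) * M.
suff DL n : `|series x n * series y n - series (cauchy_product x y) n| <=
    geometric L q' n.
  apply/cvgr0Pnorm_le => e e0.
  have q'0 : `|q'| < 1 by rewrite ger0_norm// (le_trans q0)// ltW.
  have /cvgr0Pnorm_le/(_ e e0) := @cvg_geometric _ L _ q'0.
  apply: filterS => n; apply: le_trans; apply: le_trans (DL n) _.
  exact: ler_norm.
rewrite /series/= sum_cauchy_product mulr_suml -sumrB.
apply: le_trans (ler_norm_sum _ _ _) _.
apply: le_trans (_ : \sum_(0 <= j < n) C ^+ 2 / (1 - q) * q ^+ n <= _).
  (* Row [j] of the gap is [x j] times the block of [y] from [n - j] to [n]; the powers of [q]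
     recombine into [q ^ n] whatever [j] is. *)
  apply: ler_sum_nat => j /= jn.
  rewrite -mulrBr normrM.
  have -> : \sum_(0 <= l < n) y l - \sum_(0 <= l < n - j) y l =
      \sum_(n - j <= l < n) y l.
    by rewrite (@big_cat_nat _ _ _ (n - j) 0 n) ?leq_subr// addrAC subrr add0r.
  have yn : `|\sum_(n - j <= l < n) y l| <= C * (q ^+ (n - j) / (1 - q)).
    apply: le_trans (ler_norm_sum _ _ _) _.
    apply: le_trans (_ : \sum_(n - j <= l < n) C * q ^+ l <= _).
      by apply: ler_sum.
    by rewrite -mulr_sumr ler_wpM2l// sum_geometric_le.
  apply: le_trans (ler_pM _ _ (xC j) yn) _ => //.
  rewrite -[in leRHS](@subnKC j n) ?(ltnW jn)// exprD.
  by rewrite le_eqVlt; apply/orP; left; apply/eqP; field; lra.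
rewrite sumr_const_nat subn0 -[_ *+ n]mulr_natl.
have -> : n%:R * (C ^+ 2 / (1 - q) * q ^+ n) =
    C ^+ 2 / (1 - q) * (n%:R * q ^+ n) by ring.
rewrite /= /L -[leRHS]mulrA ler_wpM2l//.
by rewrite divr_ge0// ?sqr_ge0// subr_ge0 ltW.
Qed.

Lemma cvg_pseries_cauchy_product a b B s : 0 <= B -> B * `|s| < 1 ->
  geometric_bound a B -> geometric_bound b B ->
  pseries (cauchy_product a b) s @ \oo -->
  limn (pseries a s) * limn (pseries b s).
Proof.
move=> B0 Bs [Ca aC] [Cb bC].
have Ca0 := geometric_bound_cst_ge0 aC; have Cb0 := geometric_bound_cst_ge0 bC.
have bnd (c : nat -> R) C : 0 <= C -> (forall n, `|c n| <= C * B ^+ n) -> C <= Ca + Cb ->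
    forall n, `|c n * s ^+ n| <= (Ca + Cb) * (B * `|s|) ^+ n.
  move=> C0 cC CC n; rewrite normrM normrX exprMn mulrA ler_wpM2r ?exprn_ge0//.
  by apply: le_trans (cC n) _; rewrite ler_wpM2r// exprn_ge0.
have := cvg_series_cauchy_product (mulr_ge0 B0 (normr_ge0 s)) Bs
  (bnd _ _ Ca0 aC _) (bnd _ _ Cb0 bC _).
rewrite lerDl lerDr Ca0 Cb0 => /(_ isT isT).
apply: cvg_trans; rewrite /pseries.
suff -> : (fun i => cauchy_product a b i * s ^+ i) =
  cauchy_product (fun i => a i * s ^+ i) (fun i => b i * s ^+ i) by [].
apply/funext => n; rewrite /cauchy_product mulr_suml; apply: eq_bigr => j _.
by rewrite mulrACA -exprD subnKC// -ltnS.
Qed.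

End CauchyProduct.

(** * From the recursion on coefficients to the exponential of a power series *)

Section ExponentialFormula.
Variable R : realType.

(** Mean value theorem on the segment between 0 and [s], which stays in the ball; the sign of [s]
    decides its orientation. *)
Lemma is_derive_0_ball_cst (f : R -> R) (B s : R) : 0 <= B -> B * `|s| < 1 ->
  (forall x, B * `|x| < 1 -> is_derive x (1 : R) f 0) -> f s = f 0.
Proof.
move=> B0 Bs df.
have dfs x : `|x| <= `|s| -> is_derive x (1 : R) f 0.
  by move=> xs; apply: df; apply: le_lt_trans Bs; exact: ler_wpM2l.
have cst (a b : R) : a <= b -> (forall x, a <= x <= b -> `|x| <= `|s|) ->
    f b = f a.
  move=> ab abs; apply/eqP; rewrite -subr_eq0.
  have [||c _ ->] := @MVT_segment _ f (fun=> 0) a b ab; last by rewrite mul0r.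
    move=> x; rewrite in_itv/= => /andP[ax xb]; apply/dfs/abs.
    by rewrite !ltW.
  apply: derivable_within_continuous => x; rewrite in_itv/= => axb.
  by have [] := dfs x (abs x axb).
have [s0|s0] := leP 0 s.
  apply: cst => // x /andP[x0 xs].
  by rewrite (ger0_norm x0) (ger0_norm s0).
apply/esym/cst; first exact: ltW.
move=> x /andP[sx x0].
by rewrite (ler0_norm x0) (ltr0_norm s0) lerN2.
Qed.

(** In complex terms, [w = u + i v] solves [w' = h' w] with [h = p + i q], so [exp (- h) * w] has
    derivative 0. The two functions are its real and imaginary parts. *)
Lemma is_derive_polar (u v p q : R -> R) (dp dq s : R) :
  is_derive s (1 : R) u (dp * u s - dq * v s) ->
  is_derive s (1 : R) v (dp * v s + dq * u s) ->
  is_derive s (1 : R) p dp -> is_derive s (1 : R) q dq ->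
  is_derive s (1 : R)
    (fun x => expR (- p x) * (u x * cos (q x) + v x * sin (q x))) 0 /\
  is_derive s (1 : R)
    (fun x => expR (- p x) * (v x * cos (q x) - u x * sin (q x))) 0.
Proof.
move=> du dv dfp dfq.
have de := @is_derive1_comp R (@expR R) (- p) s _ _ (is_derive_expR (- p s)) (is_deriveN dfp).
have dc := @is_derive1_comp R (@cos R) q s _ _ (is_derive_cos (q s)) dfq.
have ds := @is_derive1_comp R (@sin R) q s _ _ (is_derive_sin (q s)) dfq.
split.
  apply: is_derive_eq (is_deriveM de (is_deriveD (is_deriveM du dc)
    (is_deriveM dv ds))) _.
  rewrite /GRing.scale/= !fctE/=; ring.
apply: is_derive_eq (is_deriveM de (is_deriveB (is_deriveM dv dc)
    (is_deriveM du ds))) _.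
rewrite /GRing.scale/= !fctE/=; ring.
Qed.

(* [x n + i y n] is the [n]-th power of a complex number of modulus at most 1. *)
Definition disc_powers (x y : nat -> R) :=
  [/\ x 0%N = 1 /\ y 0%N = 0,
      forall m n, x (m + n)%N = x m * x n - y m * y n,
      forall m n, y (m + n)%N = x m * y n + y m * x n,
      forall n, `|x n| <= 1 & forall n, `|y n| <= 1].

Lemma disc_powers1 : disc_powers (fun=> 1) (fun=> 0).
Proof. by split=> [|||n|n]; rewrite ?normr1 ?normr0//; move=> *; ring. Qed.

Lemma geometric_bound_weight (a x : nat -> R) (B : R) :
  (forall n, `|x n| <= 1) -> geometric_bound a B ->
  geometric_bound (fun n => a n * x n) B.
Proof.
by move=> x1; apply: geometric_bound_dominated => n; rewrite normrM ler_piMr.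
Qed.

(** With [x n + i y n = omega ^ n], this reads [A (omega s) = exp (C (omega s))] for the series [A]
    and [C] of [a] and [c]. Both sides solve the same linear differential equation in the real
    variable [s] and equal 1 at 0. The weight [omega = 1] will give the moment generating function
    and [omega = i] the characteristic function. *)
Lemma pseries_exponential_formula (a c x y : nat -> R) (B s : R) :
    0 <= B -> B * `|s| < 1 ->
    geometric_bound a B -> geometric_bound c B -> disc_powers x y ->
    a 0%N = 1 -> c 0%N = 0 ->
    pseries_diffs a = cauchy_product (pseries_diffs c) a ->
  let p := limn (pseries (fun n => c n * x n) s) in
  let q := limn (pseries (fun n => c n * y n) s) in
  limn (pseries (fun n => a n * x n) s) = expR p * cos q /\
  limn (pseries (fun n => a n * y n) s) = expR p * sin q.
Proof.
move=> B0 Bs ga gc [[x0 y0] xD yD x1 y1] a0 c0 rec.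
pose F (b w : nat -> R) z := limn (pseries (fun n => b n * w n) z).
move=> p q.
have diffsE b w n : pseries_diffs (fun n => b n * w n) n =
    pseries_diffs b n * w n.+1 by rewrite /pseries_diffs mulrA.
have dF (b w : nat -> R) z : (forall n, `|w n| <= 1) -> geometric_bound b B ->
    B * `|z| < 1 -> is_derive z (1 : R) (F b w)
      (limn (pseries (pseries_diffs (fun n => b n * w n)) z)).
  move=> w1 gb Bz; apply: (is_derive_pseries B0 Bz).
  exact: geometric_bound_weight.
(* The recursion multiplied by [omega ^ (n + 1)]: the exponent splits as [(j + 1) + (n - j)], one
   part for each factor of the Cauchy product. *)
have odes z : B * `|z| < 1 ->
  is_derive z (1 : R) (F a x)
    (limn (pseries (pseries_diffs (fun n => c n * x n)) z) * F a x z -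
     limn (pseries (pseries_diffs (fun n => c n * y n)) z) * F a y z) /\
  is_derive z (1 : R) (F a y)
    (limn (pseries (pseries_diffs (fun n => c n * x n)) z) * F a y z +
     limn (pseries (pseries_diffs (fun n => c n * y n)) z) * F a x z).
  move=> Bz.
  have [B1 BB1 B1z] := exists_gt_mulr_lt1 B0 (normr_ge0 z) Bz.
  have B10 : 0 <= B1 by apply: le_trans (ltW BB1).
  have cv (w w' : nat -> R) : (forall n, `|w n| <= 1) ->
      (forall n, `|w' n| <= 1) ->
      pseries (cauchy_product (pseries_diffs (fun n => c n * w n))
        (fun n => a n * w' n)) z @ \oo -->
      limn (pseries (pseries_diffs (fun n => c n * w n)) z) * F a w' z.
    move=> w1 w'1; apply: (cvg_pseries_cauchy_product B10 B1z).
      by apply: geometric_bound_diffs BB1 _ => //; exact: geometric_bound_weight.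
    by apply: geometric_bound_weight => //; exact: geometric_bound_le (ltW BB1) ga.
  have eq_F (w : nat -> R) (l : R) : (forall n, `|w n| <= 1) ->
      pseries (pseries_diffs (fun n => a n * w n)) z @ \oo --> l ->
      is_derive z (1 : R) (F a w) l.
    by move=> w1 /cvg_lim <- //; exact: dF.
  split; apply: eq_F => //.
    apply: cvg_trans (cvgB (cv _ _ x1 x1) (cv _ _ y1 y1)).
    rewrite (_ : _ - _ =
      pseries (pseries_diffs (fun n => a n * x n)) z)//.
    apply/funext => N; rewrite /pseries/series/= !fctE -sumrB.
    apply: eq_bigr => n _; rewrite -mulrBl; congr (_ * _).
    rewrite diffsE rec /cauchy_product mulr_suml -sumrB.
    apply: eq_bigr => j _; rewrite !diffsE.
    have nE : n.+1 = (j.+1 + (n - j))%N by rewrite addSn subnKC// -ltnS.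
    by rewrite (congr1 x nE) xD; ring.
  apply: cvg_trans (cvgD (cv _ _ x1 y1) (cv _ _ y1 x1)).
  rewrite (_ : _ + _ =
    pseries (pseries_diffs (fun n => a n * y n)) z)//.
  apply/funext => N; rewrite /pseries/series/= !fctE -big_split/=.
  apply: eq_bigr => n _; rewrite -mulrDl; congr (_ * _).
  rewrite diffsE rec /cauchy_product mulr_suml -big_split/=.
  apply: eq_bigr => j _; rewrite !diffsE.
  have nE : n.+1 = (j.+1 + (n - j))%N by rewrite addSn subnKC// -ltnS.
    by rewrite (congr1 y nE) yD; ring.
have F0 b w : F b w 0 = b 0%N * w 0%N by rewrite /F limn_pseries0.
(* [U + i V] is [exp (- C (omega z)) * A (omega z)], constant by [is_derive_polar] and equal to 1 at
   0. *)
pose U z := expR (- F c x z) *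
  (F a x z * cos (F c y z) + F a y z * sin (F c y z)).
pose V z := expR (- F c x z) *
  (F a y z * cos (F c y z) - F a x z * sin (F c y z)).
have UV z : B * `|z| < 1 -> is_derive z (1 : R) U 0 /\ is_derive z (1 : R) V 0.
  move=> Bz; have [du dv] := odes z Bz.
  by apply: is_derive_polar du dv (dF _ _ _ x1 gc Bz) (dF _ _ _ y1 gc Bz).
have U1 : U s = 1.
  rewrite (is_derive_0_ball_cst B0 Bs (fun z Bz => (UV z Bz).1)).
  by rewrite /U !F0 a0 c0 x0 y0 !mul0r oppr0 expR0 cos0 sin0; ring.
have V0 : V s = 0.
  rewrite (is_derive_0_ball_cst B0 Bs (fun z Bz => (UV z Bz).2)).
  by rewrite /V !F0 a0 c0 x0 y0 !mul0r oppr0 expR0 cos0 sin0; ring.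
have ep : expR p * expR (- p) = 1 by exact: expRxMexpNx_1.
have cs : cos q ^+ 2 + sin q ^+ 2 = 1 by exact: cos2Dsin2.
rewrite -/(F a x s) -/(F a y s).
move: U1 V0; rewrite /U /V -[F c x s]/p -[F c y s]/q.
move: (F a x s) (F a y s) ep cs.
set E := expR p; set E' := expR (- p); set C := cos q; set S := sin q.
(* Solving [U = 1] and [V = 0] for [u] and [v]: scale by [E] and rotate by the angle [q]. *)
move=> u v EE' CS U1 V0; split.
  transitivity (E * E' * (C ^+ 2 + S ^+ 2) * u); first by rewrite EE' CS !mul1r.
  transitivity (E * (C * (E' * (u * C + v * S)) - S * (E' * (v * C - u * S)))).
    ring.
  by rewrite U1 V0; ring.
transitivity (E * E' * (C ^+ 2 + S ^+ 2) * v); first by rewrite EE' CS !mul1r.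
transitivity (E * (S * (E' * (u * C + v * S)) + C * (E' * (v * C - u * S)))).
  ring.
by rewrite U1 V0; ring.
Qed.

End ExponentialFormula.

(** * Formal logarithm of a power series, and transfer of bounds in both directions *)

Section LogarithmicCoefficients.
Variable R : realType.
Implicit Types (a c d : nat -> R) (B : R).

(** The first [n] coefficients of the formal quotient [a' / a]. A list is built because each
    coefficient depends on all the previous ones. *)
Fixpoint log_deriv_seq a n : seq R :=
  if n is m.+1 then
    let s := log_deriv_seq a m in
    rcons s (pseries_diffs a m - \sum_(j < m) s`_j * a (m - j)%N)
  else [::].

(** As [a 0 = 1], the last term of the Cauchy product is [d n] itself, so the equation of index [n]
    can be solved for it. *)
Lemma exists_log_deriv a : a 0%N = 1 ->
  exists d, pseries_diffs a = cauchy_product d a.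
Proof.
move=> a0; pose d n := (log_deriv_seq a n.+1)`_n; exists d.
have sizeE n : size (log_deriv_seq a n) = n.
  by elim: n => //= n IH; rewrite size_rcons IH.
(* Longer lists extend shorter ones, so an entry does not depend on the list it is read from. *)
have nthE n j : (j < n)%N -> (log_deriv_seq a n)`_j = d j.
  elim: n => // n IH; rewrite ltnS leq_eqVlt => /orP[/eqP->//|jn].
  by rewrite /= nth_rcons sizeE jn IH.
apply/funext => n; rewrite /cauchy_product big_ord_recr/= subnn a0 mulr1.
rewrite {2}/d /= nth_rcons sizeE ltnn eqxx addrC.
under [X in _ - X + _]eq_bigr do rewrite nthE//.
by rewrite subrK.
Qed.

Lemma exists_log_coefficients a : a 0%N = 1 -> exists2 c, c 0%N = 0 &
  pseries_diffs a = cauchy_product (pseries_diffs c) a.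
Proof.
move=> /exists_log_deriv[d ad].
(* Formal antiderivative of [a' / a] with null constant term. *)
exists (fun n => if n is m.+1 then d m / m.+1%:R else 0) => //.
rewrite ad; congr cauchy_product; apply/funext => n.
by rewrite /pseries_diffs mulrC divfK.
Qed.

(** Strong induction on the recursion solved for [d n]. Taking [b = (C + 1) * B] makes the constant
    in the bound on [a] equal to 1, and [2 ^ (n + 1) - 1] is exactly [n + 1] plus the sum of the
    previous such factors. The rate obtained is crude, but a positive radius is enough for the
    cumulants to exist. *)
Lemma geometric_bound_log a c B : 0 <= B -> geometric_bound a B ->
    a 0%N = 1 -> c 0%N = 0 ->
    pseries_diffs a = cauchy_product (pseries_diffs c) a ->
  exists2 B', 0 <= B' & geometric_bound c B'.
Proof.
move=> B0 [C aC] a0 c0 rec; have C0 := geometric_bound_cst_ge0 aC.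
pose b := (C + 1) * B; have b0 : 0 <= b by rewrite mulr_ge0// addr_ge0.
have ab n : `|a n| <= b ^+ n.
  case: n => [|n]; first by rewrite a0 normr1 expr0.
  apply: le_trans (aC _) _; rewrite exprMn ler_wpM2r ?exprn_ge0//.
  rewrite exprS; apply: le_trans (_ : (C + 1) * 1 <= _); first by rewrite mulr1 lerDl.
  by rewrite ler_wpM2l ?addr_ge0// exprn_ege1// lerDr.
set d := pseries_diffs c in rec.
have dn n : `|d n| <= (2 ^+ n.+1 - 1) * b ^+ n.+1.
  elim/ltn_ind: n => n IH.
  have -> : d n = pseries_diffs a n - \sum_(j < n) d j * a (n - j)%N.
    by rewrite rec /cauchy_product big_ord_recr/= subnn a0 mulr1 addrC addrK.
  have sum2 : n.+1%:R + \sum_(j < n) (2 ^+ j.+1 - 1) = 2 ^+ n.+1 - 1 :> R.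
    elim: (n) => [|m IHm]; first by rewrite big_ord0; ring.
    by rewrite big_ord_recr/= -natr1 addrAC addrA IHm [2 ^+ m.+2]exprS; ring.
  rewrite -sum2 mulrDl (le_trans (ler_normB _ _))// lerD//.
    by rewrite /pseries_diffs normrM ger0_norm// ler_wpM2l.
  rewrite mulr_suml (le_trans (ler_norm_sum _ _ _))// ler_sum// => j _.
  rewrite normrM; apply: le_trans (ler_pM _ _ (IH j (ltn_ord j)) (ab _)) _ => //.
  by rewrite -mulrA -exprD addSn subnKC// ltnW.
exists (2 * b); first exact: mulr_ge0.
exists 1 => -[|n]; first by rewrite c0 normr0 expr0 mulr1.
rewrite mul1r; apply: le_trans (_ : `|d n| <= _).
  by rewrite /d /pseries_diffs normrM ler_peMl// ger0_norm// ler1n.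
apply: le_trans (dn n) _; rewrite [leRHS]exprMn ler_wpM2r ?exprn_ge0//; lra.
Qed.

(** Exponentiation does not shrink the radius: the recursion gives [a (n + 1)] a factor
    [1 / (n + 1)], which beats the constant [C / (B' - B)] beyond the index [n0]. The earlier terms
    are absorbed in [L]. *)
Lemma geometric_bound_exp a c B B' : 0 <= B -> B < B' ->
    geometric_bound (pseries_diffs c) B ->
    pseries_diffs a = cauchy_product (pseries_diffs c) a ->
  geometric_bound a B'.
Proof.
move=> B0 BB' [C dC] rec; have C0 := geometric_bound_cst_ge0 dC.
have B'0 : 0 < B' by apply: le_lt_trans BB'.
have [n0 n0C] : exists n0, C / (B' - B) <= n0%:R.
  exists (Num.bound (C / (B' - B))); apply/ltW/archi_boundP.
  by rewrite divr_ge0// subr_ge0 ltW.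
pose L := \sum_(j < n0.+1) `|a j| / B' ^+ j.
have L0 : 0 <= L by apply: sumr_ge0 => j _; rewrite divr_ge0// exprn_ge0// ltW.
exists L => n; elim/ltn_ind: n => n IH.
have [nn0|] := leqP n n0.
  rewrite -ler_pdivrMr ?exprn_gt0// /L (bigD1 (Ordinal (nn0 : (n < n0.+1)%N)))//=.
  by rewrite lerDl sumr_ge0// => j _; rewrite divr_ge0// exprn_ge0// ltW.
case: n IH => // n IH n0n.
have : n.+1%:R * `|a n.+1| <= C * L * (B' ^+ n.+1 / (B' - B)).
  rewrite -[n.+1%:R]ger0_norm// -normrM -[_ * _]/(pseries_diffs a n) rec.
  apply: le_trans (ler_norm_sum _ _ _) _.
  apply: le_trans (_ : \sum_(j < n.+1) C * L * (B' ^+ (n - j) * B ^+ j) <= _).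
    apply: ler_sum => j _; rewrite normrM.
    have jn : (n - j < n.+1)%N by rewrite ltnS leq_subr.
    apply: le_trans (ler_pM _ _ (dC j) (IH _ jn)) _ => //.
    by rewrite le_eqVlt; apply/orP; left; apply/eqP; ring.
  rewrite -mulr_sumr ler_wpM2l ?mulr_ge0// ler_pdivlMr ?subr_gt0//.
  (* The convolution of the two geometric sequences is [(B' ^ (n + 1) - B ^ (n + 1)) / (B' - B)]. *)
  by rewrite mulrC -subrXX gerBl exprn_ge0.
move=> an; rewrite -(ler_pM2l (ltr0Sn R n)); apply: le_trans an _.
have -> : C * L * (B' ^+ n.+1 / (B' - B)) = C / (B' - B) * (L * B' ^+ n.+1) by ring.
rewrite ler_wpM2r//; first by rewrite mulr_ge0// exprn_ge0// ltW.
by apply: le_trans n0C _; rewrite ler_nat ltnW.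
Qed.

End LogarithmicCoefficients.

(** * Moments and expectations of power series under exponential integrability *)

Section Moments.
Context d (T : measurableType d) (R : realType) (P : probability T R).
Variable X : {RV P >-> R}.
Implicit Types (r s : R).

Definition exp_integrable r :=
  P.-integrable [set: T] (fun x => (expR (r * `|X x|))%:E).

(** Taylor coefficient at 0 of the moment generating function. Taking [fine] loses nothing once
    [exp_integrable r] holds for some positive [r]. *)
Definition moment_coef n : R := fine ('E_P[(fun x => X x ^+ n)%R])%E / n`!%:R.

Lemma measurable_exp_abs r :
  measurable_fun [set: T] (fun x => (expR (r * `|X x|))%:E).
Proof.
apply/measurable_EFinP; apply: measurableT_comp => //.
by apply: measurable_funM => //; apply: measurableT_comp.
Qed.

Lemma expR_abs_le s (y : R) : expR (s * `|y|) <= expR (s * y) + expR (- (s * y)).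
Proof.
case: (leP 0 y) => y0; first by rewrite (ger0_norm y0) lerDl expR_ge0.
by rewrite (ltr0_norm y0) mulrN lerDr expR_ge0.
Qed.

(** [exp (r |X|) <= exp (r X) + exp (- r X)], with [r] half the radius of a ball on which the
    generating function is finite. *)
Lemma egf_converges_exp_integrable : egf_converges P X ->
  exists2 r, 0 < r & exp_integrable r.
Proof.
move=> [e /= e0 Xe]; have e20 : 0 < e / 2 by rewrite divr_gt0.
have e2 : e / 2 < e by rewrite ltr_pdivrMr// ltr_pMr// ltr1n.
have Me2 : ('M_P X (e / 2) < +oo)%E.
  by apply: Xe; rewrite /= sub0r normrN ger0_norm// ltW.
have MNe2 : ('M_P X (- (e / 2)) < +oo)%E.
  by apply: Xe; rewrite /= sub0r opprK ger0_norm// ltW.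
exists (e / 2) => //; apply/integrableP; split; first exact: measurable_exp_abs.
have mX t : measurable_fun [set: T] (fun x => (expR (X x * t))%:E).
  apply/measurable_EFinP; apply: measurableT_comp => //.
  exact: measurable_funM.
apply: le_lt_trans (lte_add_pinfty Me2 MNe2).
rewrite /mmt_gen_fun unlock -ge0_integralD//.
- apply: ge0_le_integral => //.
  + by apply: measurableT_comp => //; exact: measurable_exp_abs.
  + by apply: emeasurable_funD; exact: mX.
  + move=> x _; rewrite gee0_abs ?lee_fin ?expR_ge0//=.
    by rewrite mulrN ![X x * _]mulrC; exact: expR_abs_le.
- by move=> x _; rewrite lee_fin expR_ge0.
- exact: mX.
- by move=> x _; rewrite lee_fin expR_ge0.
- exact: mX.
Qed.

Lemma series_exp_coeff_le n (y : R) : 0 <= y ->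
  series (exp_coeff y) n <= expR y.
Proof.
move=> y0; rewrite /expR; apply: nondecreasing_cvgn_le.
  by apply: nondecreasing_series => k _ _; rewrite divr_ge0// exprn_ge0.
exact: is_cvg_series_exp_coeff.
Qed.

Lemma exp_coeff_le n (y : R) : 0 <= y -> y ^+ n / n`!%:R <= expR y.
Proof.
move=> y0; apply: le_trans (series_exp_coeff_le n.+1 y0).
rewrite /series/= big_nat_recr//= lerDr sumr_ge0// => k _.
by rewrite divr_ge0// exprn_ge0.
Qed.

Lemma measurable_RV_exprn n : measurable_fun [set: T] (fun x => X x ^+ n).
Proof. exact: measurable_funX. Qed.

(** Domination by [|X| ^ n <= n! / r ^ n * exp (r |X|)], a single term of the exponential series. *)
Lemma integrable_exprn r n : 0 < r -> exp_integrable r ->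
  P.-integrable [set: T] (fun x => (X x ^+ n)%:E).
Proof.
move=> r0 Ir.
have := integrableZl measurableT (n`!%:R / r ^+ n) Ir.
apply: le_integrable => //.
  by apply/measurable_EFinP; exact: measurable_RV_exprn.
move=> x _; rewrite -EFinM !abse_EFin lee_fin normrX.
have f0 : 0 <= n`!%:R / r ^+ n :> R by rewrite divr_ge0// exprn_ge0// ltW.
rewrite (ger0_norm (mulr_ge0 f0 (expR_ge0 _))).
have := exp_coeff_le n (mulr_ge0 (ltW r0) (normr_ge0 (X x))).
rewrite exprMn ler_pdivrMr ?ltr0n ?fact_gt0// => h.
by rewrite mulrAC ler_pdivlMr ?exprn_gt0// mulrC [leRHS]mulrC.
Qed.

Lemma integral_exprn r n : 0 < r -> exp_integrable r ->
  (\int[P]_x (X x ^+ n)%:E)%E = (moment_coef n * n`!%:R)%:E.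
Proof.
move=> r0 Ir; rewrite /moment_coef divfK ?pnatr_eq0 -?lt0n ?fact_gt0//.
by rewrite unlock fineK// integrable_fin_num//; exact: integrable_exprn Ir.
Qed.

(** The same domination, integrated: the constant is [E[exp (r |X|)]]. *)
Lemma geometric_bound_moment_coef r : 0 < r -> exp_integrable r ->
  geometric_bound moment_coef r^-1.
Proof.
move=> r0 Ir; exists (fine (\int[P]_x (expR (r * `|X x|))%:E)%E) => n.
have fin := integrable_fin_num measurableT Ir.
suff : ((`|moment_coef n| * n`!%:R)%:E <=
    (n`!%:R / r ^+ n)%:E * \int[P]_x (expR (r * `|X x|))%:E)%E.
  rewrite -[X in (_ <= _ * X)%E](fineK fin) -EFinM lee_fin exprVn.
  rewrite -mulrA mulrC ler_pM2l ?ltr0n ?fact_gt0//.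
  by rewrite mulrC.
rewrite -[n`!%:R in leLHS]ger0_norm// -normrM -abse_EFin -(integral_exprn _ r0 Ir).
rewrite -integralZl//; apply: le_trans (le_abse_integral _ _ _) _ => //.
  by apply/measurable_EFinP; exact: measurable_RV_exprn.
apply: ge0_le_integral => //.
- apply: measurableT_comp => //.
  by apply/measurable_EFinP; exact: measurable_RV_exprn.
- by apply: emeasurable_funM => //; exact: measurable_exp_abs.
- move=> x _; rewrite abse_EFin -EFinM lee_fin normrX.
  have := exp_coeff_le n (mulr_ge0 (ltW r0) (normr_ge0 (X x))).
  rewrite exprMn ler_pdivrMr ?ltr0n ?fact_gt0// => h.
  by rewrite mulrAC ler_pdivlMr ?exprn_gt0// mulrC [leRHS]mulrC.
Qed.

(** Dominated convergence: since [|w n| <= 1], every partial sum is at most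
    [exp |s X| <= exp (r |X|)]. The weights allow the same argument for [exp], [cos] and [sin]. *)
Lemma cvg_expectation_series (w : nat -> R) (f : R -> R) r s :
    0 < r -> exp_integrable r -> `|s| <= r -> (forall n, `|w n| <= 1) ->
    (forall y, pseries (fun n => w n / n`!%:R) y @ \oo --> f y) ->
  P.-integrable [set: T] (fun x => (f (s * X x))%:E) /\
  pseries (fun n => moment_coef n * w n) s @ \oo -->
    fine ('E_P[(fun x => f (s * X x))%R])%E.
Proof.
move=> r0 Ir sr w1 wf.
pose F N x := (pseries (fun n => w n / n`!%:R) (s * X x) N)%:E.
have mF N : measurable_fun [set: T] (F N).
  apply/measurable_EFinP; rewrite /pseries/series/=.
  apply: measurable_sum => n; apply: measurable_funM => //.
  by apply: measurable_funX; exact: measurable_funM.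
have Ff x : F N x @[N --> \oo] --> (f (s * X x))%:E.
  by apply: cvg_EFin; [exact: nearW|exact: wf].
have Fle x N : (`|F N x| <= (expR (r * `|X x|))%:E)%E.
  rewrite abse_EFin lee_fin; apply: le_trans (ler_norm_sum _ _ _) _.
  apply: le_trans (_ : expR `|s * X x| <= _); last first.
    by rewrite ler_expR normrM ler_wpM2r.
  apply: le_trans (series_exp_coeff_le N (normr_ge0 _)).
  apply: ler_sum => n _; rewrite !normrM normfV normrX normr_nat exp_coeffE/=.
  by rewrite -normrM ler_wpM2r ?exprn_ge0// ler_piMl.
have mf : measurable_fun [set: T] (fun x => (f (s * X x))%:E).
  by apply: emeasurable_fun_cvg mF _ => x _; exact: Ff.
have [|//|If _ cvF] := @dominated_convergence _ _ _ P _ measurableT F _ _ mF mf _ Ir.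
  by apply: aeW => x _; exact: Ff.
  by apply: aeW => x N _; exact: Fle.
split=> //; rewrite unlock.
have finf := integrable_fin_num measurableT If.
move: cvF; rewrite -[X in _ --> X](fineK finf) => /fine_cvg.
rewrite (_ : fine \o _ = pseries (fun n => moment_coef n * w n) s)//.
apply/funext => N /=; rewrite /F /pseries/series/=.
under eq_integral do rewrite -sumEFin.
rewrite integral_sum//; last first.
  move=> n; have := integrableZl measurableT (w n / n`!%:R * s ^+ n)
    (integrable_exprn n r0 Ir).
  by apply: eq_integrable => // x _; rewrite -EFinM exprMn mulrA.
suff int n : (\int[P]_x (w n / n`!%:R * (s * X x) ^+ n)%:E)%E =
    (moment_coef n * w n * s ^+ n)%:E.
  rewrite (eq_bigr (fun n => (moment_coef n * w n * s ^+ n)%:E)) => [|n _].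
    by rewrite sumEFin.
  exact: int.
under eq_integral do rewrite exprMn mulrA EFinM.
rewrite integralZl//; last exact: integrable_exprn Ir.
rewrite (integral_exprn _ r0 Ir) -EFinM; congr EFin.
by field; rewrite pnatr_eq0 -lt0n fact_gt0.
Qed.

End Moments.

(** * Exponential integrability recovered from the growth of moments *)

Section ExponentialMoments.
Context d (T : measurableType d) (R : realType) (P : probability T R).
Variable X : {RV P >-> R}.
Implicit Types (r s B : R).

Lemma one_plus_sign_mul_exprn_ge0 (y : R) n : 0 <= (1 + (-1) ^+ n) * y ^+ n.
Proof.
case: (boolP (odd n)) => n2.
  by rewrite -signr_odd n2 expr1 subrr mul0r.
by rewrite -signr_odd (negPf n2) expr0 mulr_ge0// exprn_even_ge0.
Qed.

Lemma cvg_series_cosh (y : R) :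
  series (fun n => (1 + (-1) ^+ n) * y ^+ n / n`!%:R) @ \oo -->
  expR y + expR (- y).
Proof.
have cv z : series (@exp_coeff R z) @ \oo --> expR z.
  exact: is_cvg_series_exp_coeff.
rewrite [X in X @ _](_ : _ = series (exp_coeff y) + series (exp_coeff (- y))).
  exact: cvgD.
apply/funext => n; rewrite /series/= fctE -big_split/=.
by apply: eq_bigr => k _; rewrite /exp_coeff/= [(- y) ^+ k]exprNn; ring.
Qed.

Lemma nneseries_EFin (u : nat -> R) l : series u @ \oo --> l ->
  (\sum_(0 <= n <oo) (u n)%:E = l%:E)%E.
Proof.
move=> ul; apply/cvg_lim => //.
rewrite (_ : (fun n => _) = EFin \o series u).
  by apply: cvg_EFin => //; exact: nearW.
by apply/funext => n; rewrite /= sumEFin.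
Qed.

(* Only the even moments are known to be absolute moments, hence cosh. *)
Lemma exp_integrable_geometric_bound r s B : 0 < r -> exp_integrable X r ->
    0 <= s -> 0 <= B -> B * s < 1 -> geometric_bound (moment_coef X) B ->
  exp_integrable X s.
Proof.
move=> r0 Ir s0 B0 Bs gm.
apply/integrableP; split; first exact: measurable_exp_abs.
(* The terms of the series of [2 * cosh (s X)]; being nonnegative, they can be summed under the
   integral before any integrability at [s] is known. *)
pose g n (x : T) := (1 + (-1) ^+ n) * (s * X x) ^+ n / n`!%:R.
have g0 n x : 0 <= g n x by rewrite divr_ge0// one_plus_sign_mul_exprn_ge0.
have mg n : measurable_fun [set: T] (fun x => (g n x)%:E).
  apply/measurable_EFinP; apply: measurable_funM => //.
  apply: measurable_funM => //; apply: measurable_funX.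
  exact: measurable_funM.
apply: le_lt_trans (_ : (\int[P]_x \sum_(0 <= n <oo) (g n x)%:E < +oo)%E).
  apply: ge0_le_integral => //.
  - by apply: measurableT_comp => //; exact: measurable_exp_abs.
  - by apply: ge0_emeasurable_sum => // n x _ _; rewrite lee_fin.
  - move=> x _; rewrite (nneseries_EFin (@cvg_series_cosh (s * X x))).
    by rewrite gee0_abs ?lee_fin ?expR_ge0// expR_abs_le.
rewrite integral_nneseries//; last by move=> n x _; rewrite lee_fin.
have int n : (\int[P]_x (g n x)%:E)%E =
    (moment_coef X n * (1 + (-1) ^+ n) * s ^+ n)%:E.
  rewrite /g; under eq_integral.
    move=> x _.
    rewrite exprMn (_ : _ / _ = (1 + (-1) ^+ n) * s ^+ n / n`!%:R * X x ^+ n).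
      rewrite EFinM; over.
    by ring.
  rewrite integralZl//; last exact: integrable_exprn Ir.
  rewrite (integral_exprn _ r0 Ir) -EFinM; congr EFin.
  by field; rewrite pnatr_eq0 -lt0n fact_gt0.
rewrite (eq_eseriesr (fun n _ => int n)).
have cv : cvgn (pseries (fun n => moment_coef X n * (1 + (-1) ^+ n)) s).
  apply: (@is_cvg_pseries_geometric_bound _ _ B); rewrite ?ger0_norm//.
  case: gm => C mC; exists (C * 2) => n; rewrite normrM mulrAC.
  apply: ler_pM => //; rewrite (le_trans (ler_normD _ _))// normrX normrN !normr1.
  by rewrite expr1n.
by rewrite (nneseries_EFin cv) ltry.
Qed.

End ExponentialMoments.

(** * Existence and uniqueness of cumulants, and their recursion with the moments *)

Section Cumulants.
Context d (T : measurableType d) (R : realType) (P : probability T R).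

(** Two candidate series have the same limit near 0. Convergence at the single point [e / 2] bounds
    both coefficient sequences geometrically, so [pseries_eq0] applies to their difference. *)
Lemma is_cumulants_unique (X : T -> R) (k k' : nat -> R) :
  is_cumulants P X k -> is_cumulants P X k' -> k = k'.
Proof.
move=> [_ kX] [_ k'X].
pose b n := k n / n`!%:R; pose b' n := k' n / n`!%:R.
have [e /= e0 bb'] : \forall z \near (0 : R),
  pseries b z @ \oo --> ln (fine ('M_P X z)%E) /\
  pseries b' z @ \oo --> ln (fine ('M_P X z)%E).
  by near=> z; split; near: z.
have e20 : 0 < e / 2 by rewrite divr_gt0.
have [be b'e] : pseries b (e / 2) @ \oo --> ln (fine ('M_P X (e / 2))%E) /\
    pseries b' (e / 2) @ \oo --> ln (fine ('M_P X (e / 2))%E).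
  by apply: bb'; rewrite /= sub0r normrN gtr0_norm// gtr_pMr// invf_lt1// ltr1n.
have geo (c : nat -> R) (l : R) : pseries c (e / 2) @ \oo --> l ->
    geometric_bound c `|e / 2|^-1.
  move=> cl; apply: geometric_bound_cvg_pseries; first by rewrite gt_eqF.
  by apply/cvg_ex; exists l.
apply/funext => n; apply/eqP; rewrite -subr_eq0.
have : (b - b') n = 0.
  apply: (@pseries_eq0 _ _ `|e / 2|^-1).
  - by rewrite invr_gt0 normr_gt0 gt_eqF.
  - by apply: geometric_boundB; [exact: geo be|exact: geo b'e].
  exists e => // z /= /bb'[bz b'z]; apply/cvg_lim => //.
  rewrite -[X in _ --> X](subrr (ln (fine ('M_P X z)%E))).
  rewrite (_ : pseries _ _ = pseries b z - pseries b' z); first exact: cvgB.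
  apply/funext => m; rewrite /pseries/series/= !fctE -sumrB.
  by apply: eq_bigr => j _; rewrite mulrBl.
rewrite !fctE /b /b' -mulrBl => /eqP.
by rewrite mulf_eq0 invr_eq0 pnatr_eq0 -leqn0 leqNgt fact_gt0 orbF.
Unshelve. all: by end_near. Qed.

Variable X : {RV P >-> R}.

Lemma moment_coef0 : moment_coef X 0 = 1.
Proof.
rewrite /moment_coef (_ : (fun x => _) = cst 1); last first.
  by apply/funext => x; rewrite expr0.
by rewrite expectation_cst/= fact0 divr1.
Qed.

Lemma cvg_moment_coef_mgf (r s : R) :
    0 < r -> exp_integrable X r -> `|s| <= r ->
  pseries (moment_coef X) s @ \oo --> fine ('M_P X s)%E.
Proof.
move=> r0 Ir sr.
have [|y|_] := @cvg_expectation_series _ _ _ _ X (fun=> 1) (@expR R) r s r0 Ir sr.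
- by move=> n; rewrite normr1.
- rewrite /pseries; under eq_fun do rewrite div1r mulrC.
  exact: is_cvg_series_exp_coeff.
rewrite (_ : (fun n => _ * 1) = moment_coef X); last first.
  by apply/funext => n; rewrite mulr1.
rewrite (_ : (fun x => _) = (expR \o s \o* X))//.
by apply/funext => x /=; rewrite mulrC.
Qed.

(** The exponential formula with [omega = 1] identifies the generating function with the exponential
    of the series of [c]; it remains to take logarithms. *)
Lemma log_coef_is_cumulants (c : nat -> R) (r B : R) :
    0 < r -> exp_integrable X r -> 0 <= B -> geometric_bound c B ->
    c 0%N = 0 ->
    pseries_diffs (moment_coef X) =
      cauchy_product (pseries_diffs c) (moment_coef X) ->
  is_cumulants P X (fun n => c n * n`!%:R).
Proof.
move=> r0 Ir B0 gc c0 rec; split; first by rewrite c0 mul0r.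
have gm := geometric_bound_moment_coef r0 Ir.
have rV0 : 0 < r^-1 by rewrite invr_gt0.
(* The rate [B + 1 / r] dominates those of [c] and of the moments, and its disc lies within
   [|z| <= r]. *)
have B'0 : 0 < B + r^-1 by rewrite ltr_wpDl.
exists (B + r^-1)^-1 => /=; first by rewrite invr_gt0.
move=> z /=; rewrite sub0r normrN -[ltRHS]mulr1 mulrC ltr_pdivlMr// mulrC => Bz.
have zr : `|z| <= r.
  rewrite -[leLHS]mul1r -(mulVf (lt0r_neq0 r0)) mulrAC -[leRHS]mul1r.
  rewrite ler_wpM2r ?ltW//; apply: le_lt_trans Bz.
  by rewrite ler_wpM2r// lerDr.
rewrite (_ : (fun n => _) = c); last first.
  by apply/funext => n; rewrite mulfK// pnatr_eq0 -lt0n fact_gt0.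
have gc' : geometric_bound c (B + r^-1).
  by apply: geometric_bound_le gc => //; rewrite lerDl ltW.
have [] := pseries_exponential_formula (ltW B'0) Bz
  (geometric_bound_le (ltW rV0) (_ : r^-1 <= B + r^-1) gm) gc'
  (disc_powers1 R) moment_coef0 c0 rec.
  by rewrite lerDr.
rewrite (_ : (fun n => _ * 1) = moment_coef X); last first.
  by apply/funext => n; rewrite mulr1.
rewrite (_ : (fun n => _ * 1) = c); last first.
  by apply/funext => n; rewrite mulr1.
rewrite (_ : (fun n => _ * 0) = fun=> 0); last first.
  by apply/funext => n; rewrite mulr0.
have -> : limn (pseries (fun=> 0) z) = 0.
  apply/cvg_lim => //; rewrite (_ : pseries _ _ = fun=> 0); first exact: cvg_cst.
  by apply/funext => n; rewrite /pseries/series/= big1// => i _; rewrite mul0r.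
rewrite cos0 mulr1 => mE _.
rewrite -(cvg_lim _ (cvg_moment_coef_mgf r0 Ir zr))// mE expRK.
exact: is_cvg_pseries_geometric_bound (ltW B'0) Bz gc'.
Qed.

Lemma cumulant_recursion : egf_converges P X ->
  let c n := cumulant P X n / n`!%:R in
  c 0%N = 0 /\
  pseries_diffs (moment_coef X) =
    cauchy_product (pseries_diffs c) (moment_coef X).
Proof.
move=> /egf_converges_exp_integrable[r r0 Ir].
have [c c0 rec] := exists_log_coefficients moment_coef0.
have [B B0 gc] : exists2 B, 0 <= B & geometric_bound c B.
  apply: geometric_bound_log (geometric_bound_moment_coef r0 Ir) _ c0 rec.
    by rewrite invr_ge0 ltW.
  exact: moment_coef0.
have ck := log_coef_is_cumulants r0 Ir B0 gc c0 rec.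
(* The set defining [cumulant] is inhabited, so [xget] returns one of its members and not the
   default value; uniqueness identifies it. *)
have kE : cumulant P X = fun n => c n * n`!%:R.
  by apply: (is_cumulants_unique _ ck); apply: xgetPex; exists (fun n => c n * n`!%:R).
rewrite /= kE c0 mul0r mul0r; split=> //.
rewrite rec; congr (cauchy_product (pseries_diffs _)).
by apply/funext => n; rewrite mulfK// pnatr_eq0 -lt0n fact_gt0.
Qed.

End Cumulants.

(** * The characteristic function as the exponential of the cumulant series *)

Section CharacteristicFunction.
Variable R : realType.

(** [re_weight n] and [im_weight n] are the real and imaginary parts of [i ^ n]. *)
Definition re_weight n : R := if odd n then 0 else (-1) ^+ n./2.
Definition im_weight n : R := if odd n then (-1) ^+ n./2 else 0.

Lemma norm_weights n : `|re_weight n| + `|im_weight n| = 1.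
Proof.
rewrite /re_weight /im_weight.
by case: odd; rewrite normrX normrN normr1 expr1n normr0 ?addr0 ?add0r.
Qed.

Lemma disc_powers_i : disc_powers re_weight im_weight.
Proof.
split=> [|m n|m n|n|n]; rewrite -?(norm_weights n) ?lerDl ?lerDr//.
  rewrite /re_weight /im_weight oddD halfD.
  by case: (odd m); case: (odd n); rewrite /= ?add0n ?add1n ?exprS ?exprD; ring.
rewrite /re_weight /im_weight oddD halfD.
by case: (odd m); case: (odd n); rewrite /= ?add0n ?add1n ?exprS ?exprD; ring.
Qed.

Lemma cvg_pseries_cos (y : R) :
  pseries (fun n => re_weight n / n`!%:R) y @ \oo --> cos y.
Proof.
rewrite (_ : pseries _ y = series (cos_coeff y)).
  by have := @is_cvg_series_cos_coeff R y; rewrite unlock.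
congr series; apply/funext => n; rewrite cos_coeffE/= /re_weight.
by case: odd; rewrite /= ?mul0r ?mul1r.
Qed.

Lemma cvg_pseries_sin (y : R) :
  pseries (fun n => im_weight n / n`!%:R) y @ \oo --> sin y.
Proof.
rewrite (_ : pseries _ y = series (sin_coeff y)).
  by have := @is_cvg_series_sin_coeff R y; rewrite unlock.
congr series; apply/funext => -[|n]; rewrite sin_coeffE/= /im_weight/= ?mul0r//.
by rewrite uphalf_half; case: odd; rewrite /= ?mul0r ?mul1r.
Qed.

Context d (T : measurableType d) (P : probability T R).
Variable X : {RV P >-> R}.

(** The radius [r] given by [egf_converges] may be smaller than [|s|]. The bound on [c] passes to
    the moments, hence to exponential integrability beyond [|s|], and there the exponential formula
    with [omega = i] meets the series of [cos] and [sin]. *)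
Lemma expectation_cos_sin_cumulants (B s : R) :
    let c n := cumulant P X n / n`!%:R in
    egf_converges P X -> 0 <= B -> B * `|s| < 1 -> geometric_bound c B ->
  let p := limn (pseries (fun n => c n * re_weight n) s) in
  let q := limn (pseries (fun n => c n * im_weight n) s) in
  fine ('E_P[(fun x => cos (s * X x))%R])%E = expR p * cos q /\
  fine ('E_P[(fun x => sin (s * X x))%R])%E = expR p * sin q.
Proof.
move=> c Xegf B0 Bs gc p q.
have [r r0 Ir] := egf_converges_exp_integrable Xegf.
have [c0 rec] := cumulant_recursion Xegf.
(* One increase of the rate pays for differentiating [c], the next for exponentiating. *)
have [B1 BB1 B1s] := exists_gt_mulr_lt1 B0 (normr_ge0 s) Bs.
have B10 : 0 < B1 by apply: le_lt_trans BB1.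
have [B2 BB2 B2s] := exists_gt_mulr_lt1 (ltW B10) (normr_ge0 s) B1s.
have B20 : 0 < B2 by apply: lt_trans BB2.
have gm : geometric_bound (moment_coef X) B2.
  apply: (geometric_bound_exp (ltW B10) BB2) rec.
  exact: (geometric_bound_diffs B0 BB1 gc).
(* Here the point is enlarged instead of the rate, so that [s'] is positive even if [s = 0]. *)
have [s' ss' B2s'] : exists2 s', `|s| < s' & s' * B2 < 1.
  by apply: exists_gt_mulr_lt1 => //; [exact: ltW|rewrite mulrC].
have s'0 : 0 < s' by apply: le_lt_trans ss'.
have Is' : exp_integrable X s'.
  apply: (exp_integrable_geometric_bound r0 Ir _ _ _ gm); rewrite 1?ltW//.
  by rewrite mulrC.
have gc2 : geometric_bound c B2.
  by apply: geometric_bound_le gc => //; rewrite ltW// (lt_trans BB1).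
have [_ _ _ x1 y1] := disc_powers_i.
have [<- <-] := pseries_exponential_formula (ltW B20) B2s gm gc2 disc_powers_i
  (moment_coef0 X) c0 rec.
have [_ /cvg_lim->//] := cvg_expectation_series s'0 Is' (ltW ss') x1 cvg_pseries_cos.
by have [_ /cvg_lim->//] := cvg_expectation_series s'0 Is' (ltW ss') y1 cvg_pseries_sin.
Qed.

(** The recursion read at indices 0 and 1, with [m_0 = 1] and [m_1 = 0]. *)
Lemma low_order_cumulants : egf_converges P X -> ('E_P[X] = 0)%E ->
  cumulant P X 1 = 0 /\ cumulant P X 2 = 2 * moment_coef X 2.
Proof.
move=> Xegf X0; have [c0 rec] := cumulant_recursion Xegf.
have m0 := moment_coef0 X.
have m1 : moment_coef X 1 = 0.
  by rewrite /moment_coef; under eq_fun do rewrite expr1; rewrite X0 mul0r.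
have := congr1 (fun f => f 0%N) rec; have := congr1 (fun f => f 1%N) rec.
rewrite /pseries_diffs /cauchy_product !big_ord_recr !big_ord0/= m0 m1.
rewrite (factS 1) (factS 0) fact0/= !muln1 !mulr0 !mulr1 !add0r => k2 k1.
split; lra.
Qed.

(** The scaling factor lets one computation serve both the original variable and the normalised
    one. *)
Lemma centered_scaled_variance (b : R) : egf_converges P X -> ('E_P[X] = 0)%E ->
  ('V_P[(fun x => X x * b)%R] = (2 * moment_coef X 2 * b ^+ 2)%:E)%E.
Proof.
move=> Xegf X0; have [r r0 Ir] := egf_converges_exp_integrable Xegf.
have iX : (X : T -> R) \in Lfun P 1.
  apply/Lfun1_integrable; have := integrable_exprn 1 r0 Ir.
  by apply: eq_integrable => // x _; rewrite /= expr1.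
have E0 : ('E_P[(fun x => X x * b)%R] = 0)%E.
  by rewrite (expectationZl b iX) X0 mule0.
rewrite /variance covariance.unlock E0/= unlock.
under eq_integral.
  move=> x _.
  rewrite !fctE/= subr0 (_ : X x * b * (X x * b) = b ^+ 2 * X x ^+ 2); last by ring.
  rewrite EFinM; over.
rewrite integralZl//; last exact: integrable_exprn Ir.
by rewrite (integral_exprn 2 r0 Ir) -EFinM mulrC [X in X * _]mulrC.
Qed.

End CharacteristicFunction.

(** * Elementary inequalities for the exponential, cosine and factorial *)

Section ElementaryBounds.
Variable R : realType.
Implicit Types (p q u x : R).

Lemma sin_norm_le x : `|sin x| <= `|x|.
Proof.
wlog x0 : x / 0 <= x => [H|].
  have [|x0] := leP 0 x; first exact: H.
  by rewrite -(normrN x) -(normrN (sin x)) -sinN H// oppr_ge0 ltW.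
have [c _ /eqP] := @MVT_segment _ (@sin R) (@cos R) 0 x x0
  (fun z _ => is_derive_sin z)
  (continuous_subspaceT (@continuous_sin R)).
rewrite sin0 !subr0 => /eqP->.
by rewrite normrM ler_piMl// cos_max.
Qed.

Lemma one_sub_cos_le x : 2 * (1 - cos x) <= x ^+ 2.
Proof.
have -> : 2 * (1 - cos x) = 4 * sin (x / 2) ^+ 2.
  have -> : cos x = cos ((x / 2) *+ 2) by congr cos; field.
  by rewrite cos_mulr2n sin2cos2; ring.
have := sin_norm_le (x / 2); rewrite -ler_sqr ?nnegrE// !real_normK ?num_real//.
by rewrite exprMn exprVn; lra.
Qed.

Lemma expR_sub1_norm_le x : `|expR x - 1| <= `|x| * expR `|x|.
Proof.
have [x0|x0] := leP 0 x.
  have e1 : 1 <= expR x by have := expR_ge1Dx x; lra.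
  rewrite !ger0_norm ?subr_ge0//.
  have := expR_ge1Dx (- x); have := expRxMexpNx_1 x; have := expR_gt0 x.
  nra.
have e1 : expR x <= 1 by rewrite -expR0 ler_expR ltW.
rewrite ler0_norm ?subr_le0// (ltr0_norm x0).
have := expR_ge1Dx x; have : 1 <= expR (- x) by rewrite -expR0 ler_expR; lra.
nra.
Qed.

(* [|e^w - 1| <= |w| e^|w|] for [w = p + i q]. *)
Lemma norm_cexp_sub1_le p q u : `|p| + `|q| <= u ->
  (expR p * cos q - 1) ^+ 2 + (expR p * sin q) ^+ 2 <= (u * expR u) ^+ 2.
Proof.
move=> pqu.
(* This splits the squared distance to 1 into a radial part, controlled by [p], and an angular part,
   controlled by [q]; then [p ^ 2 + q ^ 2 <= (|p| + |q|) ^ 2]. *)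
have -> : (expR p * cos q - 1) ^+ 2 + (expR p * sin q) ^+ 2 =
    (expR p - 1) ^+ 2 + expR p * (2 * (1 - cos q)).
  by rewrite !exprMn sin2cos2; ring.
have pu : `|p| <= u by apply: le_trans pqu; rewrite lerDl.
have u0 : 0 <= u by apply: le_trans pu.
have eu1 : 1 <= expR u by rewrite -expR0 ler_expR.
have epu : expR p <= expR u by rewrite ler_expR (le_trans (ler_norm p)).
have H1 : (expR p - 1) ^+ 2 <= `|p| ^+ 2 * expR u ^+ 2.
  rewrite -exprMn -real_normK ?num_real// lerXn2r ?nnegrE ?mulr_ge0 ?expR_ge0//.
  apply: le_trans (expR_sub1_norm_le p) _.
  by rewrite ler_wpM2l// ler_expR.
have H2 : expR p * (2 * (1 - cos q)) <= `|q| ^+ 2 * expR u ^+ 2.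
  have c0 : 0 <= 2 * (1 - cos q) by rewrite mulr_ge0// subr_ge0 cos_le1.
  rewrite mulrC; apply: ler_pM c0 (expR_ge0 _) _ _.
    by rewrite real_normK ?num_real// one_sub_cos_le.
  by apply: le_trans epu _; rewrite expr2 ler_peMl// expR_ge0.
apply: le_trans (lerD H1 H2) _; rewrite -mulrDl exprMn ler_wpM2r ?sqr_ge0//.
apply: le_trans (_ : (`|p| + `|q|) ^+ 2 <= _).
  by rewrite sqrrD lerD2r lerDl mulrn_wge0.
by rewrite lerXn2r ?nnegrE ?addr_ge0.
Qed.

(** With [n = r + 3], this is [n ^ (n - 2) / n! <= e ^ (n - 3) / 2]: equality at [n = 3], and the
    ratio of consecutive left sides is [(1 + 1 / n) ^ (n - 2) <= e]. *)
Lemma exprn_divfact_le r :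
  r.+3%:R ^+ r.+1 / r.+3`!%:R <= expR 1 ^+ r / 2 :> R.
Proof.
elim: r => [|r IH].
  rewrite !factS fact0 expr1 expr0 !muln1; lra.
have e1r : (1 + r.+3%:R^-1) ^+ r.+1 <= expR 1 :> R.
  apply: le_trans (_ : expR (r.+3%:R^-1) ^+ r.+1 <= _).
    by rewrite lerXn2r ?nnegrE ?expR_ge0 ?expR_ge1Dx// addr_ge0.
  rewrite -expRM_natl ler_expR ler_pdivrMr// mul1r ler_nat.
  by rewrite ltnS ltnW// ltnS.
have -> : r.+4%:R ^+ r.+2 / r.+4`!%:R =
    (1 + r.+3%:R^-1) ^+ r.+1 * (r.+3%:R ^+ r.+1 / r.+3`!%:R) :> R.
  rewrite mulrA -exprMn (_ : (1 + _) * _ = r.+4%:R :> R); last first.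
    by rewrite mulrDl mul1r mulVf// natr1.
  rewrite [X in X / _]exprS factS natrM invfM.
  rewrite mulrACA mulfV// mul1r//.
rewrite [expR 1 ^+ _]exprS -[leRHS]mulrA; exact: ler_pM.
Qed.

End ElementaryBounds.

(** * Estimate of the cumulant series from the third order on *)

Section TailBound.
Variable R : realType.
Let e : R := expR 1.

Lemma ltr1_expR1 : 1 < e.
Proof. by rewrite /e -expR0 ltr_expR. Qed.

Variables (c : nat -> R) (N D A s : R).
Hypotheses (N0 : 0 < N) (D0 : 0 < D) (A0 : 0 < A).
Hypotheses (c0 : c 0%N = 0) (c1 : c 1%N = 0).
Hypothesis c_le : forall n, (2 <= n)%N ->
  `|c n| <= N * n%:R ^+ (n - 2) * (2 * D) ^+ (n - 1) * A ^+ n / n`!%:R.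

Lemma cumulant_coef_le n :
  `|c n.+3| <= N / (4 * D) * e ^+ n * (2 * D * A) ^+ n.+3.
Proof.
apply: le_trans (c_le _) _ => //; rewrite !subSS !subn0.
have -> : N * n.+3%:R ^+ n.+1 * (2 * D) ^+ n.+2 * A ^+ n.+3 / n.+3`!%:R =
    N / (2 * D) * (2 * D * A) ^+ n.+3 * (n.+3%:R ^+ n.+1 / n.+3`!%:R).
  rewrite [in RHS]exprMn [(2 * D) ^+ n.+3]exprS; field.
  by rewrite pnatr_eq0 -lt0n fact_gt0 gt_eqF.
apply: le_trans (ler_wpM2l _ (exprn_divfact_le R n)) _.
  by rewrite mulr_ge0// ?exprn_ge0// ?divr_ge0// ?mulr_ge0// ltW.
by rewrite le_eqVlt; apply/orP; left; apply/eqP; rewrite /e; field; rewrite gt_eqF.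
Qed.

(** The constant [N / (2 * D)] accounts for the exponent [n - 1] of [2 * D]. Orders 0 and 1 vanish,
    and from order 2 on a factor 1/2 is to spare. *)
Lemma geometric_bound_cumulant_coef : geometric_bound c (2 * D * A * e).
Proof.
have e1 := ltr1_expR1.
have DA0 : 0 < 2 * D * A by rewrite !mulr_gt0.
have ND0 : 0 < N / (2 * D) by rewrite divr_gt0// mulr_gt0.
exists (N / (2 * D)) => -[|[|[|n]]].
- by rewrite c0 normr0 expr0 mulr1 ltW.
- by rewrite c1 normr0 mulr_ge0 ?exprn_ge0 ?ltW// mulr_gt0// (lt_trans _ e1).
- apply: le_trans (c_le _) _ => //; rewrite expr0 mulr1 expr1.
  have -> : N * (2 * D) * A ^+ 2 / 2`!%:R = N / (2 * D) * ((2 * D * A) ^+ 2 / 2).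
    by rewrite (_ : 2`! = 2)//; field; rewrite gt_eqF.
  rewrite ler_pM2l// [leRHS]exprMn ler_pM2l ?exprn_gt0//; nra.
apply: le_trans (cumulant_coef_le n) _.
have -> : N / (4 * D) * e ^+ n * (2 * D * A) ^+ n.+3 =
    N / (2 * D) * ((2 * D * A) ^+ n.+3 * (e ^+ n / 2)).
  by field; rewrite gt_eqF.
rewrite [(2 * D * A * e) ^+ _]exprMn.
rewrite ler_pM2l// ler_pM2l ?exprn_gt0// -addn3 exprD ler_pM2l ?exprn_gt0//.
  by have : 1 <= e ^+ 3 by [rewrite exprn_ege1// ltW]; lra.
exact: lt_trans e1.
Qed.

Hypothesis s_le : 2 * D * A * `|s| <= (2 + e)^-1.

Lemma cumulant_coef_radius : 2 * D * A * e * `|s| < 1.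
Proof.
have e1 := ltr1_expR1.
rewrite mulrAC; apply: le_lt_trans (ler_wpM2r _ s_le) _; first lra.
by rewrite mulrC ltr_pdivrMr; lra.
Qed.

(** With [y = 2 * D * A * |s|], the tail is at most [N / (4 * D) * y ^ 3] times a geometric series
    of ratio [e * y <= e / (2 + e)], whose sum is at most [(2 + e) / 2]. Since [y ^ 3] contributes a
    factor 8, the numerical constants cancel and leave [2 + e]. *)
Lemma cumulant_tail_le :
  `|limn (pseries (fun n => c n * re_weight R n) s) + c 2 * s ^+ 2| +
  `|limn (pseries (fun n => c n * im_weight R n) s)| <=
  (2 + e) * N * D ^+ 2 * A ^+ 3 * `|s| ^+ 3.
Proof.
have e1 := ltr1_expR1.
have [_ _ _ x1 y1] := disc_powers_i R.
have B0 : 0 <= 2 * D * A * e by rewrite !mulr_ge0// ltW// (lt_trans _ e1).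
have cv w : (forall n, `|w n| <= 1) ->
    cvgn (pseries (fun n => c n * w n) s).
  move=> w1; apply: is_cvg_pseries_geometric_bound B0 cumulant_coef_radius _.
  exact: geometric_bound_weight w1 geometric_bound_cumulant_coef.
set p := limn _; set q := limn _; set u := (X in _ <= X).
have pq : `|pseries (fun n => c n * re_weight R n) s n + c 2 * s ^+ 2| +
    `|pseries (fun n => c n * im_weight R n) s n| @[n --> \oo] -->
    `|p + c 2 * s ^+ 2| + `|q|.
  apply: cvgD; apply: cvg_norm; last exact: cv.
  by apply: cvgD; [exact: cv|exact: cvg_cst].
(* It suffices to bound the partial sums having at least three terms. *)
apply: cvgr_to_le pq _; exists 3%N => // m /= m3.
rewrite -(subnK m3) addn3; set n := (m - 3)%N.
have tailE w k : pseries (fun n => c n * w n) s k.+3 =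
    c 2%N * w 2%N * s ^+ 2 + \sum_(0 <= i < k) c i.+3 * w i.+3 * s ^+ i.+3.
  rewrite /pseries/series/= big_nat_recl// big_nat_recl// big_nat_recl//.
  by rewrite c0 c1 !mul0r !add0r.
have re2 : re_weight R 2 = -1 by rewrite /re_weight/= expr1.
have im2 : im_weight R 2 = 0 by [].
(* As [i ^ 2 = -1], adding [c 2 * s ^ 2] removes the quadratic term of the real part; the imaginary
   part has none. *)
rewrite !tailE re2 im2 mulr0 mul0r add0r mulrN1 mulNr addrAC addNr add0r.
apply: le_trans (lerD (ler_norm_sum _ _ _) (ler_norm_sum _ _ _)) _.
rewrite -big_split/=.
pose y := 2 * D * A * `|s|.
have y0 : 0 <= y by rewrite !mulr_ge0// ltW.
have ey1 : e * y <= e / (2 + e) by rewrite ler_pM2l// (lt_trans _ e1).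
have ey2 : e / (2 + e) = 1 - 2 / (2 + e) by field; lra.
have ie0 : 0 < 2 / (2 + e) by rewrite divr_gt0//; lra.
apply: le_trans (_ : \sum_(0 <= i < n) N / (4 * D) * y ^+ 3 * (e * y) ^+ i <= _).
  apply: ler_sum => i _.
  rewrite ![`|_ * s ^+ _|]normrM ![`|c _ * _|]normrM.
  (* For each order one weight is 0 and the other has modulus 1, so estimating both parts together
     loses no factor 2. *)
  rewrite -mulrDl -mulrDr norm_weights mulr1 normrX.
  apply: le_trans (ler_wpM2r _ (cumulant_coef_le i)) _; first exact: exprn_ge0.
  rewrite le_eqVlt; apply/orP; left; apply/eqP.
  rewrite /y -[i.+3]addn3 [`|s| ^+ _]exprD [(2 * D * A) ^+ _]exprD !exprMn; ring.
rewrite -mulr_sumr.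
apply: le_trans (_ : N / (4 * D) * y ^+ 3 * ((2 + e) / 2) <= _).
  rewrite ler_wpM2l//.
    by rewrite mulr_ge0 ?exprn_ge0// divr_ge0// ?mulr_ge0// ltW.
  apply: le_trans (@sum_geometric_le R (e * y) 0 n _ _) _.
  - by rewrite mulr_ge0// ltW// (lt_trans _ e1).
  - by lra.
  rewrite expr0 div1r -[leRHS]invf_div lef_pV2 ?posrE//; lra.
rewrite le_eqVlt; apply/orP; left; apply/eqP.
by rewrite /u /y !exprMn; field; rewrite gt_eqF.
Qed.

End TailBound.

Local Open Scope complex_scope.

(** * Bound on the Gaussian residue of the unscaled variable *)

Section ResidueBound.
Context d (T : measurableType d) (R : realType) (P : probability T R).
Variable X : {RV P >-> R}.
Let e : R := expR 1.

(** Here [2 * moment_coef X 2] is the variance, so the Gaussian factor is [exp (c_2 s ^ 2)] and the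
    residue is [exp w] with [w] the series controlled by [cumulant_tail_le]. The bound [u] is kept
    abstract to receive its form in the rescaled frequency. *)
Lemma gaussian_residue_le (N D A s u : R) :
    egf_converges P X -> ('E_P[X] = 0)%E ->
    0 < N -> 0 < D -> 0 < A -> 2 * D * A * `|s| <= (2 + e)^-1 ->
    (forall r, (2 <= r)%N -> `|cumulant P X r| <=
      N * r%:R ^+ (r - 2) * (2 * D) ^+ (r - 1) * A ^+ r) ->
    u = (2 + e) * N * D ^+ 2 * A ^+ 3 * `|s| ^+ 3 ->
  `|gaussian_residue P X (2 * moment_coef X 2) s - 1| <= (u * expR u)%:C.
Proof.
move=> Xegf X0 N0 D0 A0 s_le k_le uE.
pose c n := cumulant P X n / n`!%:R.
have [c0 _] := cumulant_recursion Xegf.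
have [k1 k2] := low_order_cumulants Xegf X0.
have c1 : c 1%N = 0 by rewrite /c k1 mul0r.
have c2 : c 2%N = moment_coef X 2 by rewrite /c k2 (_ : 2`! = 2)//; field.
have c_le n : (2 <= n)%N ->
    `|c n| <= N * n%:R ^+ (n - 2) * (2 * D) ^+ (n - 1) * A ^+ n / n`!%:R.
  move=> n2; rewrite /c normrM normfV normr_nat ler_wpM2r//.
  exact: k_le.
have e1 := ltr1_expR1 R.
have B0 : 0 <= 2 * D * A * e by rewrite !mulr_ge0// ltW// (lt_trans _ e1).
have gc := geometric_bound_cumulant_coef N0 D0 A0 c0 c1 c_le.
have := cumulant_tail_le N0 D0 A0 c0 c1 c_le s_le; rewrite -uE.
have [] := expectation_cos_sin_cumulants Xegf B0
  (cumulant_coef_radius s_le) gc.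
rewrite -/c; set p := limn _; set q := limn _ => cosE sinE pqu.
rewrite /gaussian_residue /char_fun cosE sinE.
rewrite normc_def lecR.
have -> : u * expR u = Num.sqrt ((u * expR u) ^+ 2).
  by rewrite sqrtr_sqr ger0_norm// mulr_ge0 ?expR_ge0// (le_trans _ pqu)// addr_ge0.
rewrite ler_wsqrtr//; apply: le_trans (norm_cexp_sub1_le pqu).
rewrite expRD /= c2 !mulr0 !subr0 add0r.
rewrite (_ : 2 * moment_coef X 2 * s ^+ 2 / 2 = moment_coef X 2 * s ^+ 2); last by field.
by rewrite le_eqVlt; apply/orP; left; apply/eqP; ring.
Qed.

End ResidueBound.

(** * Rescaling and the constants of the zone of control *)

Theorem lemma29 (R : realType) (d : nat -> measure_display)
    (T : forall n, measurableType (d n)) (P : forall n, probability (T n) R)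
    (S : forall n, {RV (P n) >-> R}) (D N : nat -> R) (A : R)
    (D_gt0 : forall n, 0 < D n) (N_gt0 : forall n, 0 < N n) (A_gt0 : 0 < A)
    (S_egf : forall n, egf_converges (P n) (S n))
    (S_centered : forall n, ('E_(P n)[S n] = 0)%E)
    (S_bounds : uniform_cumulant_bounds P (fun n => S n : T n -> R) D N A) :
  let sigma2 := fun n => fine ('V_(P n)[S n]) / (N n * D n) in
  let X := fun n (x : T n) =>
    S n x / (powR (N n) (1 / 3) * powR (D n) (2 / 3)) in
  let t := fun n => sigma2 n * powR (N n / D n) (1 / 3) in
  let e := expR 1 : R in
  let K := 1 / ((8 + 4 * e) * A ^+ 3) in
  let K1 := (2 + e) * A ^+ 3 in
  let K2 := (2 + e) * A ^+ 3 in
  [/\ forall n, ('V_(P n)[X n] = (t n)%:E)%E,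
      forall (n : nat) (xi : R), - (K * t n) <= xi <= K * t n ->
        `|gaussian_residue (P n) (X n) (t n) xi - 1|
          <= (K1 * `|xi| ^+ 3 * expR (K2 * `|xi| ^+ 3))%:C
    & 0 < K /\ K <= 1 / (4 * K2)].
Proof.
move=> sigma2 X t e K K1 K2.
have e1 : 1 < e := ltr1_expR1 R.
(* In terms of the cube roots [a] and [b] of [N] and [D], all normalisations become rational:
   [X = S / (a b ^ 2)] and [t = V / (a ^ 2 b ^ 4)]. *)
pose a n := N n `^ (1 / 3); pose b n := D n `^ (1 / 3).
have a0 n : 0 < a n by exact: powR_gt0.
have b0 n : 0 < b n by exact: powR_gt0.
have cube (x : R) : 0 < x -> (x `^ (1 / 3)) ^+ 3 = x.
  move=> x0; rewrite -powR_mulrn ?powR_ge0// -powRrM.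
  by rewrite (_ : 1 / 3 * 3%:R = 1) ?powRr1 ?ltW//; field.
have aN n : N n = a n ^+ 3 by rewrite cube.
have bD n : D n = b n ^+ 3 by rewrite cube.
have D23 n : D n `^ (2 / 3) = b n ^+ 2.
  by rewrite -powR_mulrn ?ltW// -powRrM; congr (_ `^ _); field.
have ND13 n : (N n / D n) `^ (1 / 3) = a n / b n.
  rewrite powRM ?ltW// ?invr_gt0//; congr (_ * _).
  by rewrite -[(D n)^-1]powR_inv1 ?ltW// -powRrM mulN1r powRN.
pose V n := 2 * moment_coef (S n) 2.
have VS n (k : R) : ('V_(P n)[(fun x => S n x * k)%R] = (V n * k ^+ 2)%:E)%E.
  exact: centered_scaled_variance.
have VE n : fine ('V_(P n)[S n])%E = V n.
  have := congr1 fine (VS n 1); rewrite expr1n mulr1/= => <-.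
  by congr (fine (variance _ _)); apply/funext => x; rewrite mulr1.
have tE n : t n = V n / (a n ^+ 2 * b n ^+ 4).
  rewrite /t /sigma2 VE ND13 aN bD; field.
  by rewrite !gt_eqF.
have XE n x : X n x = S n x * (a n * b n ^+ 2)^-1 by rewrite /X D23.
split.
- move=> n; rewrite (_ : X n = fun x => S n x * (a n * b n ^+ 2)^-1).
    rewrite VS tE; congr EFin; field.
    by rewrite !gt_eqF.
  by apply/funext => x; rewrite XE.
- move=> n xi xiK.
  (* The frequency at which [S] is evaluated, since [xi * X = s * S]. *)
  pose s := xi / (a n * b n ^+ 2).
  have K0 : 0 < K by rewrite divr_gt0// mulr_gt0 ?exprn_gt0//; lra.
  (* The cumulant bound of order 2 is [Var S <= 2 N D A ^ 2]; it turns the zone in terms of [t] into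
     one in terms of [N] and [D]. *)
  have t_le : t n <= 2 * A ^+ 2 * (a n / b n).
    have [_ k2] := low_order_cumulants (S_egf n) (S_centered n).
    have := S_bounds n 2 isT; rewrite k2 -/(V n) expr0 expr1 mulr1 => VN.
    rewrite tE ler_pdivrMr ?mulr_gt0 ?exprn_gt0//.
    apply: le_trans (ler_norm _) (le_trans VN _).
    rewrite aN bD le_eqVlt; apply/orP; left; apply/eqP; field.
    by rewrite gt_eqF.
  have xi_le : `|xi| <= K * (2 * A ^+ 2 * (a n / b n)).
    apply: le_trans (_ : K * t n <= _); first by rewrite ler_norml.
    by rewrite ler_pM2l.
  have ns : `|s| = `|xi| / (a n * b n ^+ 2).
    by rewrite normrM normfV [`|_ * _|]gtr0_norm// mulr_gt0// exprn_gt0.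
  (* This determines [K]: at the end of the zone the left side becomes [4 * A ^ 3 * K], which equals
     [1 / (2 + e)]. *)
  have s_le : 2 * D n * A * `|s| <= (2 + e)^-1.
    rewrite ns.
    apply: le_trans (_ : 2 * D n * A *
      (K * (2 * A ^+ 2 * (a n / b n)) / (a n * b n ^+ 2)) <= _).
      apply: ler_wpM2l; first by rewrite ltW// !mulr_gt0.
      by rewrite ler_wpM2r// invr_ge0 ltW// mulr_gt0// exprn_gt0.
    rewrite bD /K le_eqVlt; apply/orP; left; apply/eqP; field.
    by rewrite !gt_eqF//; lra.
  (* The normalisation is chosen so that [N * D ^ 2 * |s| ^ 3 = |xi| ^ 3]. *)
  have uE : K1 * `|xi| ^+ 3 =
      (2 + e) * N n * D n ^+ 2 * A ^+ 3 * `|s| ^+ 3.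
    rewrite /K1 ns aN bD; field.
    by rewrite !gt_eqF.
  have := gaussian_residue_le (S_egf n) (S_centered n) (N_gt0 n) (D_gt0 n)
    A_gt0 s_le (S_bounds n) uE.
  rewrite (_ : gaussian_residue _ _ (t n) xi =
    gaussian_residue (P n) (S n) (2 * moment_coef (S n) 2) s)//.
  rewrite /gaussian_residue /char_fun.
  congr (_ * _); last first.
    congr ((expR _)%:C); rewrite -/(V n) tE /s; field.
    by rewrite !gt_eqF.
  congr (_ +i* _).
    congr (fine (expectation _ _)); apply/funext => x; congr cos.
    by rewrite XE /s; field; rewrite !gt_eqF.
  congr (fine (expectation _ _)); apply/funext => x; congr sin.
  by rewrite XE /s; field; rewrite !gt_eqF.
- have A3 : 0 < A ^+ 3 by rewrite exprn_gt0.
  split; first by rewrite /K divr_gt0// mulr_gt0//; lra.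
  (* Equality holds, as [8 + 4 e = 4 (2 + e)]. *)
  rewrite /K /K2 le_eqVlt; apply/orP; left; apply/eqP; field.
  by rewrite !gt_eqF//; lra.
Qed.
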